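(* Let $R=R_1\times\cdots\times R_s$ be a finite commutative ring with $1\neq0$, where each $R_i$ is a finite local ring with maximal ideal $M_i$ of order $m_i$, $|R_1|/m_1\le\cdots\le|R_s|/m_s$, and $|R_i|/m_i\equiv1\pmod4$ for all $1\le i\le s$. Let $R_0$ be a finite local ring with maximal ideal $M_0$ of order $m_0$ with $|R_0|/m_0\equiv3\pmod4$. Then (a) $E(\mathcal{G}_R)=\frac{|R^\times|}{2^s}\prod_{i=1}^s\left(\sqrt{|R_i|/m_i}+1\right)$; (b) $E(\mathcal{G}_{R_0\times R})=\frac{|R_0^\times||R^\times|}{2^{s-1}}\prod_{i=1}^s\left(\sqrt{|R_i|/m_i}+1\right)$.
   Context: A local ring is a commutative ring with a unique maximal ideal. For a finite commutative ring $S$, $S^\times$ is its unit group, $Q_S=\{u^2:u\in S^\times\}$, $T_S=Q_S\cup(-Q_S)$, and the quadratic unitary Cayley graph $\mathcal{G}_S$ has vertex set $S$ with $x,y$ adjacent iff $x-y\in T_S$. The energy $E(G)$ is the sum of absolute values of the adjacency eigenvalues of $G$, with multiplicity. *)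

(* Defs.v *)
From HB Require Import structures.
From mathcomp Require Import all_boot all_order all_algebra.

Set Implicit Arguments.
Unset Strict Implicit.
Unset Printing Implicit Defensive.

Import GRing.Theory.
Local Open Scope ring_scope.

(* MathComp declares the finite and the ring structures of A * B separately;
   this joins them, making the product of two finite rings a finite ring. *)
HB.saturate prod.

Section LocalRing.
Variable R : finComUnitRingType.
Implicit Types M N I : {set R}.

(* [idealr_closed] already includes properness, as 1 \notin I. *)
Definition maximal_ideal M : Prop :=
  idealr_closed M /\ (forall I, idealr_closed I -> M \subset I -> I = M).

Definition local_ring_with M : Prop :=
  maximal_ideal M /\ (forall N, maximal_ideal N -> N = M).

(* The division is exact: M is an additive subgroup of R. *)
Definition residue_card M : nat := #|R| %/ #|M|.

End LocalRing.

Section QuadraticUnitaryCayleyGraph.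
Variable R : finComUnitRingType.

Definition units : {set R} := [set u | u \is a GRing.unit].

Definition unit_squares : {set R} := [set u ^+ 2 | u in units].

Definition connection_set : {set R} :=
  unit_squares :|: [set - x | x in unit_squares].

Definition quc_graph : rel R := fun x y => x - y \in connection_set.

End QuadraticUnitaryCayleyGraph.

Section Energy.
Variables (C : numClosedFieldType) (V : finType) (e : rel V).

Definition adjacency : 'M[C]_#|V| :=
  \matrix_(i, j) (e (enum_val i) (enum_val j))%:R.

(* The roots of the characteristic polynomial, repeated according to
   multiplicity: char_poly adjacency = \prod_(z <- spectrum) ('X - z%:P). *)
Definition spectrum : seq C :=
  sval (closed_field_poly_normal (char_poly adjacency)).

Definition energy : C := \sum_(z <- spectrum) `|z|.

End Energy.

(* The direct product of a finite family of rings, with componentwise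
   operations; it is the zero ring when the family is empty. *)
Section ProductRing.
Variables (I : finType) (R_ : I -> finComUnitRingType).

Definition prod_ring : Type := {dffun forall i : I, R_ i}.

HB.instance Definition _ := Finite.on prod_ring.

Implicit Types f g : prod_ring.

Definition prod_add f g : prod_ring := [ffun i => f i + g i].
Definition prod_opp f : prod_ring := [ffun i => - f i].
Definition prod_zero : prod_ring := [ffun i => 0].
Definition prod_mul f g : prod_ring := [ffun i => f i * g i].
Definition prod_one : prod_ring := [ffun i => 1].

Fact prod_addA : associative prod_add.
Proof. by move=> f g h; apply/ffunP=> i; rewrite !ffunE addrA. Qed.
Fact prod_addC : commutative prod_add.
Proof. by move=> f g; apply/ffunP=> i; rewrite !ffunE addrC. Qed.
Fact prod_add0 : left_id prod_zero prod_add.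
Proof. by move=> f; apply/ffunP=> i; rewrite !ffunE add0r. Qed.
Fact prod_addN : left_inverse prod_zero prod_opp prod_add.
Proof. by move=> f; apply/ffunP=> i; rewrite !ffunE addNr. Qed.

HB.instance Definition _ :=
  GRing.isZmodule.Build prod_ring prod_addA prod_addC prod_add0 prod_addN.

Fact prod_mulA : associative prod_mul.
Proof. by move=> f g h; apply/ffunP=> i; rewrite !ffunE mulrA. Qed.
Fact prod_mulC : commutative prod_mul.
Proof. by move=> f g; apply/ffunP=> i; rewrite !ffunE mulrC. Qed.
Fact prod_mul1 : left_id prod_one prod_mul.
Proof. by move=> f; apply/ffunP=> i; rewrite !ffunE mul1r. Qed.
Fact prod_mulD : left_distributive prod_mul +%R.
Proof. by move=> f g h; apply/ffunP=> i; rewrite !ffunE mulrDl. Qed.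

HB.instance Definition _ := GRing.Zmodule_isComPzRing.Build prod_ring
  prod_mulA prod_mulC prod_mul1 prod_mulD.

End ProductRing.

(* Main.v *)
Require Import Defs.
From HB Require Import structures.
From mathcomp Require Import all_boot all_order all_fingroup all_algebra.
From mathcomp Require Import cyclic.
From mathcomp Require Import ring.

Set Implicit Arguments.
Unset Strict Implicit.
Unset Printing Implicit Defensive.

Import Order.TTheory GRing.Theory Num.Theory.
Local Open Scope ring_scope.

(* Each of the graphs is symmetric, so its adjacency matrix A is diagonalizable
   and energies multiply along tensor products of graphs.  As -1 is a square in
   every R_i, the graph of R is the tensor product of the graphs of the R_i, and
   that of R_0 x R is the tensor product of those of R_0 and R.

   For a local ring with maximal ideal M of order m and residue field of odd
   order q, the unit squares have index 2 in the unit group and are M-invariant.  If q = 3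
   mod 4, then the connection set consists of all the units and A^2 + mA is a
   multiple of the all-ones matrix J.  If q = 1 mod 4, then the Jacobsthal sum of
   the quadratic character gives A^2 = m(q-1)/4 (N + J) - mA, where N is the
   indicator of x - y in M; hence A^3 + mA^2 - m^2(q-1)/4 A is a multiple of J.
   These relations determine the energy: on the roots of the annihilating cubic
   the absolute value is a polynomial of degree at most 2, so that the energy is
   a combination of the traces of A, A^2 and J. *)

(** * Energy and diagonalization *)

Lemma char_poly_similar (F : fieldType) n (P A : 'M[F]_n) :
  P \in unitmx -> char_poly (invmx P *m A *m P) = char_poly A.
Proof.
move=> Pu; rewrite /char_poly /char_poly_mx !map_mxM map_invmx.
set Q := map_mx _ P; have Qu : Q \in unitmx by rewrite map_unitmx.
have -> : 'X%:M - invmx Q *m map_mx polyC A *m Q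
    = invmx Q *m ('X%:M - map_mx polyC A) *m Q.
  rewrite mulmxBr mulmxBl; congr (_ - _).
  by rewrite -mulmxA -scalar_mxC mulmxA mulVmx // mul1mx.
by rewrite !det_mulmx mulrC mulrA -det_mulmx mulmxV // det1 mul1r.
Qed.

Section EnergyDiag.
Variables (C : numClosedFieldType) (V : finType).
Implicit Types (e : rel V) (a : V -> V -> C) (d : V -> C) (phi psi : V -> V -> C).

(* [phi w] is a left eigenvector of [a] for the eigenvalue [d w], and [psi] is the
   inverse of [phi]; eigenvectors are indexed by the vertices themselves, so that
   a diagonalization of a product is indexed by the product. *)
Definition diagonalizes a d phi psi : Prop :=
  (forall w w', \sum_v phi w v * psi v w' = (w == w')%:R) /\
  (forall x y, a x y = \sum_w psi x w * d w * phi w y).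

Definition kernel_mx a : 'M[C]_#|V| := \matrix_(i, j) a (enum_val i) (enum_val j).

Lemma sum_enum_val (F : V -> C) : \sum_x F x = \sum_(i < #|V|) F (enum_val i).
Proof. exact/reindex/onW_bij/enum_val_bij. Qed.

Lemma kernel_mxM a b :
  kernel_mx a *m kernel_mx b = kernel_mx (fun x y => \sum_z a x z * b z y).
Proof.
apply/matrixP=> i j; rewrite !mxE sum_enum_val.
by apply: eq_bigr => k _; rewrite !mxE.
Qed.

Lemma eq_energy (e1 e2 : rel V) : e1 =2 e2 -> energy C e1 = energy C e2.
Proof.
move=> e12; rewrite /energy /spectrum (_ : adjacency C e1 = adjacency C e2) //.
by apply/matrixP=> i j; rewrite !mxE e12.
Qed.

(** Similar matrices share their characteristic polynomial, and a split monic polynomial determines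
    its roots up to permutation; hence the choice made in [spectrum] is harmless. *)
Lemma energy_similar_diag e (P : 'M[C]_#|V|) (D : 'rV_#|V|) :
  P \in unitmx -> adjacency C e = invmx P *m diag_mx D *m P ->
  energy C e = \sum_i `|D 0 i|.
Proof.
move=> Pu AE; rewrite /energy /spectrum.
case: closed_field_poly_normal => r /= rE.
have monA := char_poly_monic (adjacency C e).
move: rE; rewrite (monicP monA) scale1r AE char_poly_similar //.
rewrite char_poly_trig; last first.
  by apply/is_trig_mxP=> i j ij; rewrite mxE -val_eqE (ltn_eqF ij).
under [LHS]eq_bigr do rewrite mxE eqxx mulr1n.
have -> : \prod_(i < #|V|) ('X - (D 0 i)%:P) =
    \prod_(z <- [seq D 0 i | i <- enum 'I_#|V|]) ('X - z%:P).
  by rewrite big_map big_enum.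
by move/prod_XsubC_eq => Er; rewrite -(perm_big _ Er) big_map big_enum.
Qed.

Lemma energy_diagonalizes e d phi psi :
  diagonalizes (fun x y => (e x y)%:R) d phi psi -> energy C e = \sum_w `|d w|.
Proof.
move=> [inv aE]; have PQ : kernel_mx phi *m kernel_mx psi = 1%:M.
  rewrite kernel_mxM; apply/matrixP=> i j.
  by rewrite !mxE inv (inj_eq enum_val_inj).
have [Pu Qu] := mulmx1_unit PQ.
have QE : kernel_mx psi = invmx (kernel_mx phi).
  by rewrite -[LHS](mulKmx Pu) PQ mulmx1.
rewrite (@energy_similar_diag e (kernel_mx phi) (\row_i d (enum_val i))) //.
  rewrite sum_enum_val.
  by apply: eq_bigr => i _; rewrite mxE.
rewrite -QE; apply/matrixP=> i j; rewrite !mxE aE sum_enum_val.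
by apply: eq_bigr => k _; rewrite mul_mx_diag !mxE.
Qed.

(** A real symmetric matrix is Hermitian, hence normal, and the spectral theorem applies. *)
Lemma symmetric_similar_diag e : symmetric e ->
  exists (P : 'M[C]_#|V|) (D : 'rV_#|V|),
    P \in unitmx /\ adjacency C e = invmx P *m diag_mx D *m P.
Proof.
move=> esym; set A := adjacency C e.
have /orthomx_spectralP AE : A \is normalmx.
  apply/hermitian_normalmx/realsym_hermsym.
    by apply/is_hermitianmxP; rewrite expr0 scale1r; apply/matrixP=> i j; rewrite !mxE esym.
  by apply/mxOverP=> i j; rewrite mxE realn.
by exists (spectralmx A), (spectral_diag A); rewrite spectral_unit.
Qed.

Lemma symmetric_diagonalizes e : symmetric e ->
  exists d phi psi, diagonalizes (fun x y => (e x y)%:R) d phi psi.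
Proof.
move=> /symmetric_similar_diag[P [D [Pu AE]]].
pose f (x : V) := enum_rank x.
exists (fun w => D 0 (f w)), (fun w v => P (f w) (f v)),
  (fun v w => invmx P (f v) (f w)); split=> [w w'|x y].
  rewrite sum_enum_val.
  have /matrixP/(_ (f w) (f w')) := mulmxV Pu.
  rewrite !mxE (inj_eq enum_rank_inj) => <-.
  by apply: eq_bigr => k _; rewrite /f enum_valK.
have /matrixP/(_ (f x) (f y)) := AE.
rewrite !mxE !enum_rankK => ->.
rewrite sum_enum_val.
by apply: eq_bigr => k _; rewrite mul_mx_diag !mxE /f enum_valK.
Qed.

(* On the all-ones direction the eigenvalue is [k]; every other eigenvalue is a
   root of X (X^2 + uX + v), where |X| agrees with [al X + be X^2].  Adding a
   multiple of X (X^2 + uX + v) corrects the value at [k], and the sum of the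
   absolute values becomes a combination of traces. *)
Lemma energy_regular e (k u v c al be : C) :
  symmetric e -> irreflexive e -> (0 < #|V|)%N -> 0 <= k -> c != 0 ->
  let A := adjacency C e in let J := const_mx 1 : 'M[C]_#|V| in
  A *m J = k *: J ->
  A *m (A *m A) + u *: (A *m A) + v *: A = c *: J ->
  (forall x, x * (x ^+ 2 + u * x + v) = 0 -> `|x| = al * x + be * x ^+ 2) ->
  energy C e = k + be * (#|V|%:R * k) - al * k - be * k ^+ 2.
Proof.
move=> esym eirr V0 k0 c0 A J AJ AAA absE.
have [P [D [Pu AE]]] := symmetric_similar_diag esym.
rewrite (energy_similar_diag Pu AE) -/A.
have {}AE : A = invmx P *m diag_mx D *m P := AE.
(* [K] is the all-ones matrix in the eigenbasis; a nonzero diagonal entry of [K] forces the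
   eigenvalue [k]. *)
pose K := P *m J *m invmx P.
have DE : diag_mx D = P *m A *m invmx P.
  by rewrite AE !mulmxA mulmxV // mul1mx -mulmxA mulmxV // mulmx1.
have conjM X Y : P *m (X *m Y) *m invmx P = (P *m X *m invmx P) *m (P *m Y *m invmx P).
  by rewrite !mulmxA mulmxKV.
pose p x := x * (x ^+ 2 + u * x + v).
have trC (X : 'M[C]_#|V|) : \tr (P *m X *m invmx P) = \tr X.
  by rewrite mxtrace_mulC mulmxA mulVmx // mul1mx.
have trJ : \tr J = #|V|%:R.
  by rewrite /mxtrace; under eq_bigr do rewrite mxE; rewrite sumr_const card_ord.
have JJ : J *m J = #|V|%:R *: J.
  apply/matrixP=> i j; rewrite !mxE; under eq_bigr do rewrite !mxE mulr1.
  by rewrite sumr_const card_ord mulr1.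
have DK : diag_mx D *m K = k *: K.
  by rewrite DE /K -conjM AJ -scalemxAr -scalemxAl.
have DDD : diag_mx D *m (diag_mx D *m diag_mx D) + u *: (diag_mx D *m diag_mx D)
     + v *: diag_mx D = c *: K.
  rewrite DE /K -!conjM; have /(congr1 (fun X => P *m X *m invmx P)) := AAA.
  by rewrite !(mulmxDr, mulmxDl) -!scalemxAr -!scalemxAl.
have pD i : p (D 0 i) = c * K i i.
  have /matrixP/(_ i i) := DDD.
  by rewrite !mul_diag_mx !mxE eqxx !mulr1n => <-; rewrite /p; ring.
have kD i : p (D 0 i) = 0 \/ D 0 i = k.
  have /matrixP/(_ i i) := DK; rewrite mul_diag_mx mxE [RHS]mxE => /eqP.
  rewrite -subr_eq0 -mulrBl mulf_eq0 subr_eq0 => /orP[/eqP->|/eqP K0]; first by right.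
  by left; rewrite pD K0 mulr0.
have n0 : #|V|%:R != 0 :> C by rewrite pnatr_eq0 -lt0n.
have pk : p k = c * #|V|%:R.
  have /(congr1 (fun X => X *m J)) := AAA.
  rewrite !mulmxDl -!scalemxAl -!mulmxA !AJ -!scalemxAr !AJ -!scalemxAr !AJ JJ.
  move/matrixP/(_ (Ordinal V0) (Ordinal V0)); rewrite !mxE !mulr1 => <-.
  rewrite /p; ring.
(* Chosen so that [normE] holds at the eigenvalue [k]; [pk] shows that the denominator is
   nonzero. *)
pose ga := (k - al * k - be * k ^+ 2) / p k.
have normE i : `|D 0 i| = al * D 0 i + be * D 0 i ^+ 2 + ga * p (D 0 i).
  case: (kD i) => [p0|->]; first by rewrite p0 mulr0 addr0 absE.
  rewrite ger0_norm // /ga mulfVK; last by rewrite pk mulf_neq0.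
  ring.
under eq_bigr do rewrite normE.
rewrite !big_split /= -!mulr_sumr.
have -> : \sum_i D 0 i = 0.
  rewrite -mxtrace_diag DE trC /mxtrace big1 // => i _.
  by rewrite mxE eirr.
(* For a symmetric 0/1 matrix the trace of the square is the sum of all entries, and each row sums
   to [k]. *)
have -> : \sum_i D 0 i ^+ 2 = #|V|%:R * k.
  transitivity (\tr (diag_mx D *m diag_mx D)).
    by rewrite /mxtrace; apply: eq_bigr => i _; rewrite mul_diag_mx !mxE eqxx mulr1n.
  rewrite DE -conjM trC /mxtrace.
  transitivity (\sum_(i < #|V|) (A *m J) i i).
    apply: eq_bigr => i _; rewrite !mxE; apply: eq_bigr => j _.
    by rewrite !mxE mulr1 esym; case: (e _ _); rewrite ?mulr0 ?mulr1.
  rewrite AJ; under eq_bigr do rewrite !mxE mulr1.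
  by rewrite sumr_const card_ord mulr_natl.
have -> : \sum_i p (D 0 i) = p k.
  under eq_bigr do rewrite pD.
  by rewrite -mulr_sumr -[\sum_i K i i]/(\tr K) trC trJ pk.
rewrite /ga mulfVK; last by rewrite pk mulf_neq0.
ring.
Qed.

End EnergyDiag.

(** * Tensor products of graphs *)

Section TensorEnergy.
Variable C : numClosedFieldType.

(** Products of eigenvectors diagonalize the tensor product, with the products of eigenvalues as
    eigenvalues. *)
Lemma energy_pair (V1 V2 : finType) (e1 : rel V1) (e2 : rel V2) :
  symmetric e1 -> symmetric e2 ->
  energy C [rel x y : V1 * V2 | e1 x.1 y.1 && e2 x.2 y.2] =
  energy C e1 * energy C e2.
Proof.
move=> /(symmetric_diagonalizes C)[d1 [phi1 [psi1 dg1]]].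
move=> /(symmetric_diagonalizes C)[d2 [phi2 [psi2 dg2]]].
rewrite (energy_diagonalizes dg1) (energy_diagonalizes dg2).
rewrite (@energy_diagonalizes _ _ _ (fun w => d1 w.1 * d2 w.2)
  (fun w v => phi1 w.1 v.1 * phi2 w.2 v.2) (fun v w => psi1 v.1 w.1 * psi2 v.2 w.2)).
  rewrite big_distrlr pair_big /=; apply: eq_bigr => w _; exact: normrM.
case: dg1 dg2 => [i1 a1] [i2 a2]; split=> [[w1 w2] [w1' w2']|[x1 x2] [y1 y2]] /=.
  rewrite xpair_eqE -mulnb natrM -i1 -i2 big_distrlr pair_big /=.
  by apply: eq_bigr => v _; rewrite mulrACA.
rewrite -mulnb natrM a1 a2 big_distrlr pair_big /=.
by apply: eq_bigr => v _; ring.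
Qed.

Lemma bigA_distr_dffun (S : comPzSemiRingType) (I : finType) (T_ : I -> finType)
    (F : forall i, T_ i -> S) :
  \prod_i \sum_j F i j = \sum_(f : {dffun forall i, T_ i}) \prod_i F i (f i).
Proof.
rewrite [RHS](reindex (@dffun_of_fprod _ T_)); last exact/onW_bij/dffun_of_fprod_bij.
transitivity (\sum_(t : fprod T_) \prod_i F i (t i)); last first.
  apply: eq_bigr => t _; apply: eq_bigr => i _.
  by rewrite /dffun_of_fprod ffunE.
transitivity (\sum_(t : fprod T_) \prod_(i in I) [ffun j => F i j] (t i)); last first.
  by apply: eq_bigr => t _; apply: eq_bigr => i _; rewrite ffunE.
(* Dependent functions become functions into the tagged sum, where ordinary distributivity applies;
   [untag 0] extends each [F i] by 0 to foreign tags. *)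
rewrite (big_fprod _ _ (fun i => [ffun j => F i j]))
  -(bigA_distr_big_dep (tagged_with T_) (fun i => untag 0 [ffun j => F i j])).
apply: eq_bigr => i _.
transitivity (\sum_j [ffun j => F i j] j); first by apply: eq_bigr => j _; rewrite ffunE.
exact: (big_tag (fun i => [ffun j => F i j])).
Qed.

(** The bijection [f] carries the product eigenbasis over to [V], so that the result applies to a
    ring merely isomorphic to a product. *)
Lemma energy_dffun (I : finType) (V_ : I -> finType) (e_ : forall i, rel (V_ i))
    (V : finType) (e : rel V) (f : V -> {dffun forall i, V_ i}) :
  bijective f -> (forall i, symmetric (e_ i)) ->
  (forall x y, e x y = [forall i, e_ i (f x i) (f y i)]) ->
  energy C e = \prod_i energy C (e_ i).
Proof.
move=> bf esym eE.
have /fin_all_exists[d] i := symmetric_diagonalizes C (esym i).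
move=> /fin_all_exists[phi] /fin_all_exists[psi] dg.
under eq_bigr do rewrite (energy_diagonalizes (dg _)).
rewrite bigA_distr_dffun (reindex f); last exact/onW_bij.
rewrite (@energy_diagonalizes _ _ _ (fun w => \prod_i d i (f w i))
  (fun w v => \prod_i phi i (f w i) (f v i)) (fun v w => \prod_i psi i (f v i) (f w i))).
  by apply: eq_bigr => w _; rewrite normr_prod.
have boolE (b : I -> bool) : [forall i, b i]%:R = \prod_i (b i)%:R :> C.
  case: forallP => [bT|/forallP]; first by rewrite big1 // => i _; rewrite bT.
  rewrite negb_forall => /existsP[i /negPf bi].
  by rewrite (bigD1 i) //= bi mul0r.
split=> [w w'|x y].
  have -> : (w == w') = [forall i, f w i == f w' i].
    rewrite -(inj_eq (bij_inj bf)); apply/eqP/forallP=> [-> //|ww'].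
    by apply/ffunP=> i; apply/eqP.
  rewrite boolE; under [RHS]eq_bigr do rewrite -(dg _).1.
  rewrite bigA_distr_dffun (reindex f); last exact/onW_bij.
  by apply: eq_bigr => v _; rewrite big_split.
rewrite eE boolE; under [LHS]eq_bigr do rewrite (dg _).2.
rewrite bigA_distr_dffun (reindex f); last exact/onW_bij.
by apply: eq_bigr => v _; rewrite !big_split.
Qed.

End TensorEnergy.

(* The elements of [A] moved by the involution [f] come in pairs. *)
Lemma odd_card_involution (T : finType) (A : {set T}) (f : T -> T) :
  {in A, forall x, f x \in A} -> {in A, involutive f} ->
  odd #|A| = odd #|[set x in A | f x == x]|.
Proof.
move=> fA fK; pose r := fun x : T => nat_of_ord (enum_rank x).
(* The moved elements split into those whose rank rises and those whose rank drops; [f] exchanges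
   the two sets. *)
pose L := [set x in A | (r x < r (f x))%N].
pose G := [set x in A | (r (f x) < r x)%N].
have GE : G = f @: L.
  apply/setP=> x; apply/idP/imsetP=> [|[y]]; rewrite !inE => /andP[xA lt].
    by exists (f x); rewrite ?inE ?fK ?fA.
  by move=> ->; rewrite fK // fA.
have cG : #|G| = #|L|.
  rewrite GE card_in_imset // => x y; rewrite !inE => /andP[xA _] /andP[yA _] eqf.
  by rewrite -(fK x) // eqf fK.
rewrite -(cardsID [set x | f x == x] A) setIdE oddD.
have -> : A :\: [set x | f x == x] = L :|: G.
  apply/setP=> x; rewrite !inE -andb_orr andbC; congr (_ && _).
  by rewrite -neq_ltn eq_sym (inj_eq (@ord_inj _)) (inj_eq enum_rank_inj).
rewrite cardsU cG (_ : L :&: G = set0) ?cards0 ?subn0 ?addnn ?odd_double ?addbF //.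
apply/setP=> x; rewrite !inE; case: (x \in A) => //=.
by case: ltngtP.
Qed.

(** * Unit squares and the connection set *)

Section UnitSquares.
Variable R : finComUnitRingType.
Implicit Types x y : R.

Lemma unit_squaresP x :
  reflect (exists2 u, u \is a GRing.unit & x = u ^+ 2) (x \in unit_squares R).
Proof.
by apply: (iffP imsetP) => -[u uU ->]; exists u; move: uU; rewrite ?inE.
Qed.

Lemma unit_squares_unit x : x \in unit_squares R -> x \is a GRing.unit.
Proof. by case/unit_squaresP => u uU ->; rewrite unitrX. Qed.

Lemma unit_squaresX u : u \is a GRing.unit -> u ^+ 2 \in unit_squares R.
Proof. by move=> uU; apply/unit_squaresP; exists u. Qed.

Lemma unit_squares1 : 1 \in unit_squares R.
Proof. by rewrite -(expr1n R 2) unit_squaresX ?unitr1. Qed.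

Lemma unit_squaresM x y :
  x \in unit_squares R -> y \in unit_squares R -> x * y \in unit_squares R.
Proof.
case/unit_squaresP=> u uU -> /unit_squaresP[v vU ->].
by rewrite -exprMn unit_squaresX ?unitrM ?uU.
Qed.

Lemma unit_squaresV x : x \in unit_squares R -> x^-1 \in unit_squares R.
Proof. by case/unit_squaresP=> u uU ->; rewrite -exprVn unit_squaresX ?unitrV. Qed.

Lemma connection_setE x :
  (x \in connection_set R) = (x \in unit_squares R) || (- x \in unit_squares R).
Proof.
rewrite inE; congr (_ || _); apply/imsetP/idP => [[y yQ ->]|xQ].
  by rewrite opprK.
by exists (- x); rewrite ?opprK.
Qed.

Lemma connection_setN x : (- x \in connection_set R) = (x \in connection_set R).
Proof. by rewrite !connection_setE opprK orbC. Qed.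

Lemma connection_set_squares :
  -1 \in unit_squares R -> connection_set R = unit_squares R.
Proof.
move=> N1; apply/setP=> x; rewrite connection_setE; case: (boolP (x \in _)) => //= xN.
by apply: contraNF xN => /(unit_squaresM N1); rewrite mulrNN mul1r.
Qed.

Lemma quc_graph_sym : symmetric (@quc_graph R).
Proof. by move=> x y; rewrite /quc_graph -connection_setN opprB. Qed.

Lemma quc_graph_irr : irreflexive (@quc_graph R).
Proof.
move=> x; rewrite /quc_graph subrr connection_setE oppr0 orbb.
by apply/negP => /unit_squares_unit; rewrite unitr0.
Qed.

End UnitSquares.

(** * Squares in a local ring with residue field of odd order *)

Section LocalRing.
Variables (R : finComUnitRingType) (M : {set R}).
Hypothesis locM : local_ring_with M.
Implicit Types x y u v : R.

Let U := units R.
Let Q := unit_squares R.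
Let m := #|M|.
Let q := residue_card M.

Lemma local0 : 0 \in M. Proof. by case: locM => -[[]]. Qed.

Lemma local1 : 1 \notin M. Proof. by case: locM => -[[]]. Qed.

Lemma localMD a x y : x \in M -> y \in M -> a * x + y \in M.
Proof. by case: locM => -[[_ _ H] _] _; apply: H. Qed.

Lemma localM a x : x \in M -> a * x \in M.
Proof. by move=> xM; rewrite -[_ * _]addr0 localMD ?local0. Qed.

Lemma localD x y : x \in M -> y \in M -> x + y \in M.
Proof. by move=> xM yM; rewrite -[x]mul1r localMD. Qed.

Lemma localN x : (- x \in M) = (x \in M).
Proof.
by apply/idP/idP=> xM; [rewrite -[x]opprK|]; rewrite -mulN1r localM.
Qed.

Lemma localDl x y : x \in M -> (x + y \in M) = (y \in M).
Proof.
move=> xM; apply/idP/idP=> [xyM|]; last exact: localD.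
by rewrite -(addKr x y) localD ?localN.
Qed.

Lemma localDr x y : x \in M -> (y + x \in M) = (y \in M).
Proof. by move=> xM; rewrite addrC localDl. Qed.

(** Boolean form of [idealr_closed], needed to extract a maximal set with this property. *)
Definition ideal_set (I : {set R}) : bool :=
  [&& 0 \in I, 1 \notin I & [forall a, [forall x in I, [forall y in I, a * x + y \in I]]]].

Lemma ideal_setP (I : {set R}) : reflect (idealr_closed I) (ideal_set I).
Proof.
apply: (iffP and3P) => [[I0 I1 /forallP H]|[I0 I1 H]]; split=> //.
  move=> a x y xI yI.
  by have /forall_inP/(_ x xI)/forall_inP/(_ y yI) := H a.
apply/forallP=> a; apply/forall_inP=> x xI; apply/forall_inP=> y yI.
exact: H.
Qed.

(* A non-unit generates a proper ideal, contained in a maximal one. *)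
Lemma localE x : (x \in M) = (x \notin U).
Proof.
rewrite inE; apply/idP/idP=> [xM|xN].
  by apply: contra local1 => xu; rewrite -(mulVr xu) localM.
pose I := [set a * x | a : R].
have idI : ideal_set I.
  apply/ideal_setP; split.
  - by apply/imsetP; exists 0; rewrite ?mul0r.
  - apply: contra xN => /imsetP[a _ /= a1].
    by apply/unitrP; exists a; rewrite (mulrC x) -a1.
  - move=> a _ _ /imsetP[b _ ->] /imsetP[c _ ->]; apply/imsetP.
    by exists (a * b + c); rewrite // mulrDl mulrA.
have [N /maxsetP[/ideal_setP idN maxN] IN] := maxset_exists idI.
case: locM => _ /(_ N) <-.
  by apply: (subsetP IN); apply/imsetP; exists 1; rewrite ?mul1r.
by split=> // J /ideal_setP idJ NJ; apply: maxN.
Qed.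

Lemma unitE x : (x \in U) = (x \notin M).
Proof. by rewrite localE negbK. Qed.

Lemma unitM x y : (x * y \in U) = (x \in U) && (y \in U).
Proof. by rewrite !inE unitrM. Qed.

Lemma local_group_set : group_set (M : {set FinRing.ComUnitRing_to_finGroup R}).
Proof. by apply/group_setP; split=> [|x y xM yM]; [exact: local0|exact: localD]. Qed.

Let Mg := Group local_group_set.

Lemma card_local : #|R| = (m * q)%N.
Proof.
have sMR : Mg \subset [set: FinRing.ComUnitRing_to_finGroup R] by apply: subsetT.
have := Lagrange sMR; rewrite /q /residue_card cardsT => <-.
by rewrite mulKn // cardG_gt0.
Qed.

(** The additive quotient R/M has order [q], which therefore annihilates the coset of 1. *)
Lemma residue_char : q%:R \in M.
Proof.
have nM : [set: FinRing.ComUnitRing_to_finGroup R]%g \subset 'N(Mg)%g.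
  by apply/sub_abelian_norm/subsetT; apply: FinRing.zmod_abelian.
have := expg_cardG (mem_quotient Mg (in_setT (1%R : FinRing.ComUnitRing_to_finGroup R))).
rewrite card_quotient // -divgS ?subsetT // cardsT -/(residue_card M).
rewrite -morphX ?(subsetP nM) ?inE //= => E.
exact: (coset_idr (subsetP nM _ (in_setT _)) E).
Qed.

Lemma card_local_gt0 : (0 < m)%N.
Proof. by apply/card_gt0P; exists 0; apply: local0. Qed.

Lemma card_units : #|U| = (m * q.-1)%N.
Proof.
rewrite -subn1 mulnBr muln1 -card_local -(cardsC M) addKn.
by apply: eq_card => x; rewrite unitE inE.
Qed.

Hypothesis oddq : odd q.

(** Since [q] is odd and lies in [M], having 2 in [M] would put 1 in [M]. *)
Lemma two_unit : (2%:R : R) \in U.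
Proof.
rewrite unitE; apply: contra local1 => M2.
have := residue_char; rewrite -(odd_double_half q) oddq natrD -muln2 natrM.
by rewrite localDr // localM.
Qed.

Lemma double_eq0 x : x + x = 0 -> x = 0.
Proof.
move=> xx; have := two_unit; rewrite inE => /mulrI; apply.
by rewrite mulr0 mulr_natl mulr2n.
Qed.

(** Negation is an involution of [M] whose only fixed point is 0, as 2 is a unit. *)
Lemma odd_card_local : odd m.
Proof.
rewrite /m (@odd_card_involution _ _ -%R) => [|x|x _]; rewrite ?localN ?opprK //.
rewrite (_ : [set x in M | - x == x] = [set 0]) ?cards1 //.
apply/setP=> x; rewrite !inE; apply/andP/eqP=> [[_ /eqP xN]|->].
  by apply: double_eq0; rewrite -{1}xN addNr.
by rewrite local0 oppr0.
Qed.

(** In (u - v)(u + v) = 0 the factors are not both in [M], since their difference is the unit 2v up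
    to sign; a unit factor can be cancelled. *)
Lemma eq_sqr_unit u v : v \in U -> u ^+ 2 = v ^+ 2 -> u = v \/ u = - v.
Proof.
move=> vU /eqP; rewrite -subr_eq0 subr_sqr => /eqP uv0.
have [uvM|uvU] := boolP (u - v \in M); last first.
  right; apply/eqP; rewrite -addr_eq0; apply/eqP.
  by move: uvU; rewrite -unitE inE => /mulrI; apply; rewrite mulr0.
have [uvM'|uvU] := boolP (u + v \in M); last first.
  left; apply/eqP; rewrite -subr_eq0; apply/eqP.
  by move: uvU; rewrite -unitE inE => /mulIr; apply; rewrite mul0r.
have: (u + v) - (u - v) \in M by rewrite localD ?localN.
have -> : (u + v) - (u - v) = 2 * v by ring.
by rewrite localE unitM two_unit vU.
Qed.

(** Each fibre of squaring on the units is a pair {v, -v} of distinct elements. *)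
Lemma card_units_squares : #|U| = (2 * #|Q|)%N.
Proof.
rewrite -sum1_card (partition_big_imset (fun u => u ^+ 2)) /= mulnC -sum_nat_const.
apply: eq_bigr => _ /imsetP[v vU ->].
rewrite sum1dep_card (_ : [set x | _] = [set v; - v]).
  rewrite cards2 -addr_eq0; case: eqP => // /double_eq0 v0.
  by move: vU; rewrite v0 unitE local0.
apply/setP=> x; rewrite !inE; apply/andP/orP=> [[_ /eqP /(eq_sqr_unit vU)]|].
  by case=> ->; rewrite eqxx; [left|right].
by move: vU; rewrite inE => vU [] /eqP->; rewrite ?unitrN ?sqrrN.
Qed.

Lemma card_squares : #|Q| = (m * q./2)%N.
Proof.
apply/eqP; rewrite -(eqn_pmul2l (isT : (0 < 2)%N)) -card_units_squares card_units.
by rewrite mulnCA mul2n -[in q.-1](odd_double_half q) oddq.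
Qed.

(** Inversion on [Q] fixes 1, possibly -1, and nothing else; the parity of [Q] tells whether -1
    belongs to it. *)
Lemma squaresN1 : (-1 \in Q) = ~~ odd #|Q|.
Proof.
rewrite (@odd_card_involution _ _ GRing.inv) => [|x|x _]; rewrite ?invrK //; last first.
  exact: unit_squaresV.
have fixP x : x \in Q -> (x^-1 == x) = (x == 1) || (x == -1).
  move=> xQ; have xU := unit_squares_unit xQ.
  apply/eqP/orP=> [xV|[]/eqP->]; rewrite ?invr1 ?invrN1 //.
  have : x ^+ 2 = 1 ^+ 2 by rewrite expr1n expr2 -{1}xV mulVr.
  case/eq_sqr_unit => [|->|->]; rewrite ?inE ?unitr1 ?eqxx //; first by left.
  by right.
have n1 : (1 : R) != -1.
  rewrite -addr_eq0; apply/eqP=> /double_eq0 /eqP; exact/negP/oner_neq0.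
have [N1|N1] := boolP (-1 \in Q).
  rewrite (_ : [set x in Q | _] = [set 1; -1]) ?cards2 ?n1 //.
  apply/setP=> x; rewrite !inE; apply/andP/idP=> [[xQ]|x1]; first by rewrite fixP.
  have xQ : x \in Q by case/orP: x1 => /eqP->; rewrite ?unit_squares1.
  by rewrite fixP.
rewrite (_ : [set x in Q | _] = [set 1]) ?cards1 //.
apply/setP=> x; rewrite !inE; apply/andP/idP=> [[xQ]|/eqP->].
  by rewrite fixP // => /orP[//|/eqP xN1]; rewrite -xN1 xQ in N1.
by rewrite unit_squares1 invr1.
Qed.

(* Hensel lifting by counting: y |-> (1 + y)^2 - 1 is injective on [M]. *)
Lemma squaresDr x y : y \in M -> (x + y \in Q) = (x \in Q).
Proof.
suff H u z : z \in M -> u \in Q -> u + z \in Q.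
  move=> yM; apply/idP/idP=> [|/H]; last exact.
  by rewrite -{2}(addrK y x); apply: H; rewrite localN.
move=> zM /unit_squaresP[v vU ->].
pose f := fun t : R => (1 + t) ^+ 2 - 1.
have u1 t : t \in M -> 1 + t \in U by move=> tM; rewrite unitE localDr // local1.
have fM : f @: M = M.
  apply/eqP; rewrite eqEcard; apply/andP; split.
    apply/subsetP=> _ /imsetP[t tM ->].
    have -> : f t = (2 + t) * t by rewrite /f; ring.
    exact: localM.
  (* The other case, 1 + s = -(1 + t), would put 2 in [M]. *)
  rewrite card_in_imset // => s t sM tM /addIr /(eq_sqr_unit (u1 _ tM)) [/addrI //|E].
  have: 2 + (s + t) \in M.
    have -> : 2 + (s + t) = (1 + s) + (1 + t) by ring.
    by rewrite E addNr local0.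
  by rewrite localDr; [rewrite localE two_unit|exact: localD].
have : v ^- 2 * z \in f @: M by rewrite fM localM.
case/imsetP=> t tM E.
have -> : v ^+ 2 + z = (v * (1 + t)) ^+ 2.
  have -> : z = v ^+ 2 * f t by rewrite -E mulVKr // unitrX.
  rewrite /f; ring.
by apply: unit_squaresX; rewrite unitrM vU; have := u1 _ tM; rewrite inE.
Qed.

(** The sets Q and xQ are disjoint and each is half of the units, so y lies in xQ and xy in x^2 Q =
    Q. *)
Lemma nonsquaresM x y :
  x \in U -> y \in U -> x \notin Q -> y \notin Q -> x * y \in Q.
Proof.
move=> xU yU xQ yQ; have x1 : x \is a GRing.unit by move: xU; rewrite inE.
have dis : Q :&: [set x * z | z in Q] = set0.
  apply/setP=> z; rewrite !inE; apply: contraNF xQ => /andP[zQ /imsetP[t tQ zE]].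
  by rewrite -(mulrK (unit_squares_unit tQ) x) -zE unit_squaresM ?unit_squaresV.
have : Q :|: [set x * z | z in Q] = U.
  apply/eqP; rewrite eqEcard; apply/andP; split.
    apply/subsetP=> z /setUP[zQ|/imsetP[t tQ ->]]; first by rewrite inE unit_squares_unit.
    by rewrite unitM xU inE unit_squares_unit.
  rewrite cardsU dis cards0 subn0 card_imset; last exact: mulrI.
  by rewrite card_units_squares mul2n addnn.
move/setP/(_ y); rewrite yU in_setU (negPf yQ) /= => /imsetP[t tQ ->].
by rewrite mulrA -expr2 unit_squaresM ?unit_squaresX.
Qed.

(** The number m(q - 1)/2 of unit squares is even. *)
Lemma connection_set_local1 : q = 1 %[mod 4] -> -1 \in Q.
Proof.
move=> q1; rewrite squaresN1 card_squares oddM odd_card_local /=.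
have -> : q = ((q %/ 4).*2.*2).+1.
  by rewrite {1}(divn_eq q 4) q1 -!muln2 -mulnA addn1.
by rewrite /= uphalf_double odd_double.
Qed.

(** Here m(q - 1)/2 is odd, so -1 is not a square and negation turns nonsquare units into
    squares. *)
Lemma connection_set_local3 : q = 3 %[mod 4] -> connection_set R = U.
Proof.
move=> q3; have N1 : -1 \notin Q.
  rewrite squaresN1 card_squares oddM odd_card_local /= negbK.
  have -> : q = ((q %/ 4).*2.*2).+3.
    by rewrite {1}(divn_eq q 4) q3 -!muln2 -mulnA addn3.
  by rewrite /= uphalf_double /= odd_double.
apply/setP=> x; rewrite connection_setE inE; apply/orP/idP.
  by case=> /unit_squares_unit; rewrite ?unitrN.
move=> xU; have [xQ|xQ] := boolP (x \in Q); [by left|right].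
by rewrite -mulN1r nonsquaresM // inE ?unitrN ?unitr1.
Qed.

End LocalRing.

(** * Convolution on a local ring and the energy of its graph *)

Section LocalEnergy.
Variables (C : numClosedFieldType) (R : finComUnitRingType).
Implicit Types (f g : R -> C) (x y z : R).

Definition convolution f g z := \sum_y f y * g (z - y).

(** Products of such matrices correspond to convolutions, which turns matrix relations into
    pointwise identities on [R]. *)
Definition circulant f : 'M[C]_#|R| := kernel_mx (fun x y => f (x - y)).

Lemma circulantM f g : circulant f *m circulant g = circulant (convolution f g).
Proof.
rewrite kernel_mxM; apply/matrixP=> i j; rewrite !mxE /convolution.
rewrite (reindex_inj (inj_comp (addrI (enum_val i)) oppr_inj)) /=.
by apply: eq_bigr => y _; rewrite opprD addrA subrr add0r opprK addrAC.
Qed.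

Lemma circulant1 : circulant (fun=> 1) = const_mx 1.
Proof. by apply/matrixP=> i j; rewrite !mxE. Qed.

Lemma circulantD f g : circulant f + circulant g = circulant (fun x => f x + g x).
Proof. by apply/matrixP=> i j; rewrite !mxE. Qed.

Lemma circulantZ a f : a *: circulant f = circulant (fun x => a * f x).
Proof. by apply/matrixP=> i j; rewrite !mxE. Qed.

Lemma eq_circulant f g : f =1 g -> circulant f = circulant g.
Proof. by move=> fg; apply/matrixP=> i j; rewrite !mxE. Qed.

Lemma quc_adjacency :
  adjacency C (@quc_graph R) = circulant (fun x => (x \in connection_set R)%:R).
Proof. by apply/matrixP=> i j; rewrite !mxE. Qed.

Lemma sum_indicator (A : {set R}) : \sum_x (x \in A)%:R = #|A|%:R :> C.
Proof. by rewrite -natr_sum -big_mkcond sum1_card. Qed.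

Lemma sum_convolution f g : \sum_z convolution f g z = (\sum_y f y) * (\sum_y g y).
Proof.
rewrite /convolution exchange_big mulr_suml /=; apply: eq_bigr => y _.
by rewrite mulr_sumr (reindex_inj (addIr y)) /=; apply: eq_bigr => z _; rewrite addrK.
Qed.

Lemma convolutionr1 f z : convolution f (fun=> 1) z = \sum_y f y.
Proof. by apply: eq_bigr => y _; rewrite mulr1. Qed.

Variable M : {set R}.
Hypothesis locM : local_ring_with M.
Hypothesis oddq : odd (residue_card M).

Let m : C := #|M|%:R.
Let q : C := (residue_card M)%:R.
Let n x : C := (x \in M)%:R.
Let u x : C := (x \in units R)%:R.
Let t x : C := (x \in unit_squares R)%:R.
(* The quadratic character, extended by 0 to the non-units. *)
Let eta x : C := 2 * t x - u x.

Lemma cardRE : #|R|%:R = m * q.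
Proof. by rewrite (card_local locM) natrM. Qed.

Lemma card_unitsE : #|units R|%:R = m * (q - 1).
Proof.
rewrite (card_units locM) natrM -subn1 natrB //.
by case: residue_card oddq.
Qed.

Lemma card_squaresE : #|unit_squares R|%:R = #|units R|%:R / 2 :> C.
Proof.
by rewrite (card_units_squares locM oddq) natrM mulrAC mulfV ?mul1r ?pnatr_eq0.
Qed.

Lemma card_local_neq0 : m != 0.
Proof. by rewrite pnatr_eq0 -lt0n (card_local_gt0 locM). Qed.

Lemma card_units_neq0 : #|units R|%:R != 0 :> C.
Proof.
rewrite pnatr_eq0 -lt0n; apply/card_gt0P; exists 1.
by rewrite inE unitr1.
Qed.

Lemma unit_indicator x : u x = 1 - n x.
Proof. by rewrite /u /n (unitE locM); case: (x \in M); rewrite ?subrr ?subr0. Qed.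

(** The convolution sums [f] over the coset z + M, where [f] is constant. *)
Lemma convolution_local f z :
  (forall x y, y \in M -> f (x + y) = f x) -> convolution f n z = m * f z.
Proof.
move=> fM; rewrite /convolution (reindex_inj (addrI z)) /=.
under eq_bigr => y _.
  rewrite /n opprD addrA subrr add0r (localN locM).
  have -> : f (z + y) * (y \in M)%:R = f z * (y \in M)%:R.
    by case: (boolP (y \in M)) => [yM|]; rewrite ?mulr0 // fM.
  over.
by rewrite -mulr_sumr sum_indicator mulrC.
Qed.

Lemma convolution_unit f z :
  (forall x y, y \in M -> f (x + y) = f x) ->
  convolution f u z = \sum_y f y - m * f z.
Proof.
move=> fM; rewrite -(convolution_local z fM) -[X in X - _](convolutionr1 f z) -sumrB.
by apply: eq_bigr => y _; rewrite unit_indicator mulrBr.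
Qed.

Lemma unit_indicatorDr x y : y \in M -> u (x + y) = u x.
Proof. by move=> yM; rewrite /u !(unitE locM) (localDr locM). Qed.

Lemma square_indicatorDr x y : y \in M -> t (x + y) = t x.
Proof. by move=> yM; rewrite /t (squaresDr locM). Qed.

Lemma etaDr x y : y \in M -> eta (x + y) = eta x.
Proof. by move=> yM; rewrite /eta unit_indicatorDr ?square_indicatorDr. Qed.

(** Both sides vanish when [y] is not a unit; otherwise this says that the squares have index 2 in
    the unit group. *)
Lemma etaM x y : x \in units R -> eta (x * y) = eta x * eta y.
Proof.
move=> xU; rewrite /eta /u /t (unitM x) xU /=.
have xu : x \is a GRing.unit by move: xU; rewrite inE.
have [yU|yU] := boolP (y \in units R); last first.
  have yQ z : (z * y \in unit_squares R) = false.
    apply: contraNF yU => /unit_squares_unit; rewrite unitrM inE.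
    by case/andP.
  by rewrite yQ -(mul1r y) yQ mulr0 subrr mulr0.
have yu : y \is a GRing.unit by move: yU; rewrite inE.
have [xQ|xQ] := boolP (x \in _); have [yQ|yQ] := boolP (y \in _).
- by rewrite unit_squaresM //=; ring.
- rewrite (_ : _ * _ \in _ = false); first by rewrite /=; ring.
  apply: contraNF yQ => xyQ; rewrite -(mulKr xu y).
  by rewrite unit_squaresM ?unit_squaresV.
- rewrite (_ : _ * _ \in _ = false); first by rewrite /=; ring.
  apply: contraNF xQ => xyQ; rewrite -(mulrK yu x).
  by rewrite unit_squaresM ?unit_squaresV.
- by rewrite (nonsquaresM locM) //=; ring.
Qed.

Lemma sum_eta : \sum_x eta x = 0.
Proof.
rewrite sumrB -mulr_sumr !sum_indicator card_squaresE.
by rewrite mulrC divfK ?subrr ?pnatr_eq0.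
Qed.

Lemma eta_sqr x : eta x ^+ 2 = u x.
Proof.
rewrite /eta /t /u; have [xQ|xQ] := boolP (x \in unit_squares R).
  by rewrite (_ : x \in units R) ?inE ?unit_squares_unit //=; ring.
by case: (x \in units R); rewrite /=; ring.
Qed.

(* For a unit [z], the substitution y |-> zy shows that the sum does not depend
   on [z]; its value follows by summing over all [z]. *)
Lemma jacobsthal z : eta (-1) = 1 -> convolution eta eta z = m * (q * n z - 1).
Proof.
move=> eta1; have uN1 : -1 \in units R by rewrite inE unitrN unitr1.
(* For x in M each term is eta(y) eta(-y) = eta(y)^2, the indicator of the units. *)
have convM x : x \in M -> convolution eta eta x = #|units R|%:R.
  move=> xM; rewrite -sum_indicator; apply: eq_bigr => y _.
  rewrite addrC etaDr // -mulN1r etaM // eta1 mul1r.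
  by rewrite -expr2 eta_sqr.
have convU x : x \in units R -> convolution eta eta x = convolution eta eta 1.
  move=> xU; have xu : x \is a GRing.unit by move: xU; rewrite inE.
  rewrite /convolution (reindex_inj (mulrI xu)) /=; apply: eq_bigr => y _.
  rewrite -{2}(mulr1 x) -mulrBr !etaM // mulrACA -expr2 eta_sqr /u xU.
  by rewrite mul1r.
(* The total is 0: with c the common value at units, m |U| + |U| c = 0, whence c = -m. *)
have := sum_convolution eta eta; rewrite sum_eta mul0r.
rewrite (bigID (mem M)) /= (eq_bigr _ convM) sumr_const.
rewrite (eq_big (mem (units R)) (fun=> convolution eta eta 1)) => [|x|x]; last 2 first.
- by rewrite -(unitE locM).
- by rewrite -(unitE locM) => /convU.
rewrite sumr_const -[X in X + _]mulr_natl -[X in _ + X]mulr_natl -/m mulrC -mulrDr.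
move=> /eqP; rewrite mulf_eq0 (negPf card_units_neq0) addrC addr_eq0 /= => /eqP c1.
have [zM|zM] := boolP (z \in M).
  by rewrite convM // card_unitsE /n zM mulr1.
rewrite convU ?(unitE locM) // c1 /n (negPf zM) /=; ring.
Qed.

Lemma energy_local3 :
  residue_card M = 3 %[mod 4] -> energy C (@quc_graph R) = 2 * #|units R|%:R.
Proof.
move=> q3; set k : C := #|units R|%:R.
have AE : adjacency C (@quc_graph R) = circulant u.
  by rewrite quc_adjacency (connection_set_local3 locM oddq q3).
have uu : circulant u *m circulant u = k *: circulant (fun=> 1) - m *: circulant u.
  rewrite circulantM -scaleNr !circulantZ circulantD; apply: eq_circulant => z.
  by rewrite convolution_unit ?sum_indicator ?mulr1 ?mulNr //; apply: unit_indicatorDr.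
have u1 : circulant u *m circulant (fun=> 1) = k *: circulant (fun=> 1).
  rewrite circulantM circulantZ; apply: eq_circulant => z.
  by rewrite convolutionr1 sum_indicator mulr1.
(* From A^2 = kJ - mA follows A^3 + mA^2 = k^2 J. The roots of the cubic are 0 and -m, where |x| =
   -x. *)
rewrite (@energy_regular _ _ _ k m 0 (k ^+ 2) (-1) 0).
- by ring.
- exact: quc_graph_sym.
- exact: quc_graph_irr.
- by apply/card_gt0P; exists 0.
- exact: ler0n.
- by rewrite expf_neq0 ?card_units_neq0.
- by rewrite AE -circulant1.
- rewrite AE -circulant1 {1}uu mulmxBr -!scalemxAr u1 scalerA -expr2.
  by rewrite scale0r addr0 subrK.
- move=> x /eqP; rewrite addr0 expr2 -mulrDl !mulf_eq0 addr_eq0.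
  case/or3P=> /eqP->; rewrite ?normr0 ?normrN; [ring| |ring].
  rewrite ger0_norm ?ler0n //; ring.
Qed.

Lemma energy_local1 :
  residue_card M = 1 %[mod 4] ->
  energy C (@quc_graph R) = #|units R|%:R / 2 * (sqrtC q + 1).
Proof.
move=> q1; set k : C := #|units R|%:R / 2.
have N1 := connection_set_local1 locM oddq q1.
have eta1 : eta (-1) = 1.
  rewrite /eta /t /u N1 (_ : -1 \in units R) ?inE ?unitrN ?unitr1 //=; ring.
have AE : adjacency C (@quc_graph R) = circulant t.
  by rewrite quc_adjacency connection_set_squares.
have n2 : (2 : C) != 0 by rewrite pnatr_eq0.
have tE x : t x = (eta x + u x) / 2 by rewrite /eta; by field.
have kE : k = m * (q - 1) / 2 by rewrite /k card_unitsE.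
have tt : circulant t *m circulant t =
    (k / 2) *: circulant (fun=> 1) + (k / 2) *: circulant n - m *: circulant t.
  rewrite circulantM -scaleNr !circulantZ !circulantD.
  apply: eq_circulant => z.
  (* Expand t = (eta + u)/2; the two mixed convolutions agree by commutativity. *)
  have -> : convolution t t z =
      (convolution eta eta z + 2 * convolution eta u z + convolution u u z) / 4.
    have sym : convolution u eta z = convolution eta u z.
      rewrite /convolution (reindex_inj (inj_comp (addrI z) oppr_inj)) /=.
      by apply: eq_bigr => y _; rewrite opprD opprK addrA subrr add0r mulrC.
    rewrite mulr_natl mulr2n -{1}sym /convolution -!big_split /= mulr_suml.
    apply: eq_bigr => y _; rewrite !tE; by field.
  rewrite jacobsthal // !convolution_unit; [|exact: unit_indicatorDr|exact: etaDr].
  rewrite sum_eta sum_indicator card_unitsE kE /eta unit_indicator; by field.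
have t1 : circulant t *m circulant (fun=> 1) = k *: circulant (fun=> 1).
  rewrite circulantM circulantZ; apply: eq_circulant => z.
  by rewrite convolutionr1 sum_indicator card_squaresE mulr1.
have tn : circulant t *m circulant n = m *: circulant t.
  rewrite circulantM circulantZ; apply: eq_circulant => z.
  by rewrite convolution_local //; apply: square_indicatorDr.
set r := sqrtC q.
have rq : r ^+ 2 = q by rewrite sqrtCK.
have r1 : 1 <= r.
  rewrite -sqrtC1 ler_sqrtC ?nnegrE ?ler0n ?ler01 // ler1n.
  by case: residue_card oddq.
have r0 : r != 0 by rewrite gt_eqF // (lt_le_trans ltr01).
(* The nonzero roots of the cubic are m(r - 1)/2 and -m(r + 1)/2 (the former may vanish if r = 1).
   The last two coefficients solve al + be x = 1 at the first and al + be x = -1 at the second. *)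
rewrite (@energy_regular _ _ _ k m (- (k * m / 2)) (k ^+ 2 / 2) r^-1 (2 / (m * r))).
- by rewrite cardRE kE -rq; field; rewrite card_local_neq0 r0.
- exact: quc_graph_sym.
- exact: quc_graph_irr.
- by apply/card_gt0P; exists 0.
- by rewrite divr_ge0 ?ler0n.
- by rewrite mulf_neq0 ?expf_neq0 ?mulf_neq0 ?invr_eq0 ?card_units_neq0.
- by rewrite AE -circulant1.
- rewrite AE -circulant1 {1}tt mulmxBr mulmxDr -!scalemxAr t1 tn !scalerA.
  rewrite subrK -addrA -scalerDl.
  rewrite (_ : k / 2 * m + - (k * m / 2) = 0); last by field.
  by rewrite scale0r addr0; congr (_ *: _); by field.
- move=> x /eqP; rewrite mulf_eq0 => /orP[/eqP->|]; first by rewrite normr0; ring.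
  rewrite (_ : _ + _ = (x - m * (r - 1) / 2) * (x + m * (r + 1) / 2)); last first.
    by rewrite kE -rq; by field.
  rewrite mulf_eq0 subr_eq0 addr_eq0 => /orP[]/eqP->.
    rewrite ger0_norm; first by field; rewrite card_local_neq0 r0.
    by rewrite divr_ge0 ?mulr_ge0 ?ler0n // subr_ge0.
  rewrite normrN ger0_norm; first by field; rewrite card_local_neq0 r0.
  by rewrite divr_ge0 ?mulr_ge0 ?ler0n // addr_ge0 // (le_trans ler01).
Qed.

End LocalEnergy.

(** * Products of rings *)

Section ProductDecomposition.
Variables (I : finType) (R_ : I -> finComUnitRingType) (R : finComUnitRingType).
Variable iso : {rmorphism R -> prod_ring R_}.
Hypothesis iso_bij : bijective iso.

Lemma prod_isoB x y i : iso (x - y) i = iso x i - iso y i.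
Proof. by rewrite rmorphB ffunE /= ffunE. Qed.

Lemma prod_isoM x y i : iso (x * y) i = iso x i * iso y i.
Proof. by rewrite rmorphM ffunE. Qed.

Lemma prod_iso1 i : iso 1 i = 1.
Proof. by rewrite rmorph1 ffunE. Qed.

Lemma prod_unitE x : (x \is a GRing.unit) = [forall i, iso x i \is a GRing.unit].
Proof.
have [inv isoK invK] := iso_bij.
apply/idP/forallP=> [xU i|xU].
  by apply/unitrP; exists (iso x^-1 i); rewrite -!prod_isoM mulVr ?mulrV ?prod_iso1.
pose y : R := inv [ffun i => (iso x i)^-1].
have xy : x * y = 1.
  apply: (can_inj isoK); apply/ffunP=> i.
  by rewrite prod_isoM prod_iso1 invK ffunE mulrV ?xU.
by apply/unitrP; exists y; rewrite mulrC xy.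
Qed.

Lemma prod_squaresE x :
  (x \in unit_squares R) = [forall i, iso x i \in unit_squares (R_ i)].
Proof.
have [inv isoK invK] := iso_bij.
apply/idP/forallP=> [/unit_squaresP[v vU ->] i|].
  rewrite expr2 prod_isoM -expr2; apply: unit_squaresX.
  by move: vU; rewrite prod_unitE => /forallP/(_ i).
move=> xQ; have {xQ}/fin_all_exists2[v vU xE] i :
    exists2 v, v \is a GRing.unit & iso x i = v ^+ 2 by exact/unit_squaresP.
apply/unit_squaresP; exists (inv [ffun i => v i]).
  by rewrite prod_unitE; apply/forallP=> i; rewrite invK ffunE vU.
apply: (can_inj isoK); apply/ffunP=> i.
by rewrite expr2 prod_isoM invK ffunE -expr2.
Qed.

(** The indicator of the units is the product of the componentwise indicators, and the sum
    distributes. *)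
Lemma card_prod_units : #|units R| = (\prod_i #|units (R_ i)|)%N.
Proof.
rewrite -sum1_card big_mkcond /=.
under [RHS]eq_bigr do rewrite -sum1_card big_mkcond /=.
rewrite [RHS]bigA_distr_dffun (reindex iso); last exact/onW_bij.
apply: eq_bigr => x _; rewrite inE prod_unitE; case: forallP => [xU|/forallP].
  by rewrite big1 // => i _; rewrite inE xU.
rewrite negb_forall => /existsP[i /negPf xi].
by rewrite (bigD1 i) //= inE xi mul0r.
Qed.

Hypothesis squaresN1_ : forall i, -1 \in unit_squares (R_ i).

Lemma prod_squaresN1 : -1 \in unit_squares R.
Proof.
rewrite prod_squaresE; apply/forallP=> i.
by rewrite rmorphN1 !ffunE squaresN1_.
Qed.

(** A sign in the connection set is common to all components; with -1 a square everywhere, signs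
    disappear and adjacency is componentwise. *)
Lemma energy_prod (C : numClosedFieldType) :
  energy C (@quc_graph R) = \prod_i energy C (@quc_graph (R_ i)).
Proof.
apply: (energy_dffun C iso_bij) => [i|x y]; first exact: quc_graph_sym.
rewrite /quc_graph (connection_set_squares prod_squaresN1) prod_squaresE.
by apply: eq_forallb => i; rewrite (connection_set_squares (squaresN1_ i)) prod_isoB.
Qed.

End ProductDecomposition.

Lemma pair_squaresE (R1 R2 : finComUnitRingType) (x : R1 * R2) :
  (x \in unit_squares (R1 * R2)%type) =
  (x.1 \in unit_squares R1) && (x.2 \in unit_squares R2).
Proof.
apply/unit_squaresP/andP=> [[u]|[/unit_squaresP[u uU xu] /unit_squaresP[v vU xv]]].
  by move=> /andP[u1 u2] ->; rewrite !unit_squaresX.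
by exists (u, v); [apply/andP|case: x xu xv => x1 x2 /= -> ->].
Qed.

(** The second component absorbs the common sign, which stays available to the first alone. *)
Lemma energy_pair_squares (C : numClosedFieldType) (R1 R2 : finComUnitRingType) :
  -1 \in unit_squares R2 ->
  energy C (@quc_graph (R1 * R2)%type) =
  energy C (@quc_graph R1) * energy C (@quc_graph R2).
Proof.
move=> N1; rewrite -energy_pair; [|exact: quc_graph_sym|exact: quc_graph_sym].
apply: eq_energy => x y.
rewrite /quc_graph /= !connection_setE !pair_squaresE /=.
set a := _ - _; set b := _ - _.
have -> : (- b \in unit_squares R2) = (b \in unit_squares R2).
  apply/idP/idP=> /(unit_squaresM N1); rewrite mulN1r ?opprK //.
by rewrite orbb andb_orl.
Qed.

Lemma odd_residue4 n r : n = r %[mod 4] -> odd n = odd r.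
Proof. by move=> nr; rewrite -[odd n](@odd_mod _ 4) // nr odd_mod. Qed.

Theorem theorem3p2 (C : numClosedFieldType) (s : nat)
    (R_ : 'I_s -> finComUnitRingType) (M_ : forall i, {set R_ i})
    (R : finComUnitRingType) (iso : {rmorphism R -> prod_ring R_})
    (R0 : finComUnitRingType) (M0 : {set R0}) :
  bijective iso ->
  (forall i, local_ring_with (M_ i)) ->
  (forall i j : 'I_s, (i <= j)%N ->
    (residue_card (M_ i) <= residue_card (M_ j))%N) ->
  (forall i, residue_card (M_ i) = 1 %[mod 4]) ->
  local_ring_with M0 ->
  residue_card M0 = 3 %[mod 4] ->
  energy C (@quc_graph R) =
    #|units R|%:R / 2 ^+ s *
      \prod_(i < s) (sqrtC (residue_card (M_ i))%:R + 1)
  /\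
  energy C (@quc_graph (R0 * R)%type) =
    #|units R0|%:R * #|units R|%:R / 2 ^+ (s - 1) *
      \prod_(i < s) (sqrtC (residue_card (M_ i))%:R + 1).
Proof.
move=> iso_bij loc _ q1 loc0 q3.
have odd_ i : odd (residue_card (M_ i)) by rewrite (odd_residue4 (q1 i)).
have odd0 : odd (residue_card M0) by rewrite (odd_residue4 q3).
have N1 i := connection_set_local1 (loc i) (odd_ i) (q1 i).
have ER : energy C (@quc_graph R) =
    #|units R|%:R / 2 ^+ s * \prod_(i < s) (sqrtC (residue_card (M_ i))%:R + 1).
  rewrite (energy_prod iso_bij N1).
  under eq_bigr do rewrite (energy_local1 C (loc _) (odd_ _) (q1 _)).
  rewrite !big_split /= prodfV prodr_const card_ord; congr (_ / _ * _).
  by rewrite (card_prod_units iso_bij) natr_prod.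
split=> //; rewrite (energy_pair_squares C R0 (prod_squaresN1 iso_bij N1)) ER.
rewrite (energy_local3 C loc0 odd0 q3).
(* The product of no rings is the zero ring, which [R] is not. *)
have s_gt0 : (0 < s)%N.
  rewrite lt0n; apply/eqP=> s0.
  have : iso 1 = iso 0.
    by apply/ffunP=> i; have := ltn_ord i; rewrite {2}s0.
  by move/(bij_inj iso_bij)/eqP; apply/negP/oner_neq0.
(* As 0 < s, the natural subtraction is exact; the factor 2 in the energy for [R0] cancels one power
   of 2. *)
have -> : (2 : C) ^+ s = 2 * 2 ^+ (s - 1) by rewrite -exprS subn1 prednK.
by field; rewrite expf_neq0 // pnatr_eq0.
Qed.
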